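(* Let $D$ be a positive integer, let $\mathcal{H}$ be a $D$-dimensional complex Hilbert space with orthonormal basis $\{|k\rangle\}_{k=0}^{D-1}$, and let $\omega^{x}:=e^{2\pi i x/D}$ for real $x$. Let $$|+\rangle=\frac{1}{\sqrt D}\sum_{k=0}^{D-1}|k\rangle,\qquad Z=\sum_{k=0}^{D-1}\omega^k|k\rangle\langle k|,$$ and for $t\in[0,1]$ let $$\mathrm{CP}(t)=\sum_{j,k=0}^{D-1}\omega^{jkt}\,|j\rangle\langle j|\otimes|k\rangle\langle k|.$$ Then the collection of $D^2$ normalized states in $\mathcal{H}\otimes\mathcal{H}$ $$|G_{m,n}(t)\rangle=(Z^m\otimes Z^n)\,\mathrm{CP}(t)\,|+\rangle|+\rangle,\qquad m,n=0,\ldots,D-1,$$ indexed by the real parameter $t\in[0,1]$, defines a family of equientangled bases that continuously interpolates between a product basis at $t=0$ and a maximally entangled basis at $t=1$.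
   Context: Every unit vector $|\psi\rangle=\sum_{j,k}\Omega_{jk}|j\rangle|k\rangle\in\mathcal{H}\otimes\mathcal{H}$ has Schmidt coefficients $\lambda_0,\ldots,\lambda_{D-1}\ge 0$ (counted with multiplicity), the squares of the singular values of the $D\times D$ matrix $\Omega$; they satisfy $\sum_k\lambda_k=1$. The state is a product state if exactly one Schmidt coefficient is non-zero (i.e. $|\psi\rangle=|\alpha\rangle|\beta\rangle$), and maximally entangled if all $\lambda_k=1/D$. Any pure-state entanglement measure depends only on the Schmidt coefficients. A family, indexed by $t\in[0,1]$, of collections of $D^2$ states is a ''family of equientangled bases that continuously interpolates between a product basis at $t=0$ and a maximally entangled basis at $t=1$'' if: (i) for each $t\in[0,1]$ the $D^2$ states form an orthonormal basis of $\mathcal{H}\otimes\mathcal{H}$; (ii) for each fixed $t$, all $D^2$ basis states have the same Schmidt coefficients (as a multiset), hence the same amount of entanglement; (iii) the states, and their (ordered) Schmidt coefficients, vary continuously with $t$; (iv) at $t=0$ every basis state is a product state; (v) at $t=1$ every basis state is maximally entangled. *)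

(* Defs.v *)
From mathcomp Require Import all_boot all_order all_algebra.
From mathcomp Require Import all_classical all_reals all_analysis.
From mathcomp Require Import spectral.
From mathcomp.real_closed Require Export complex mxtens.

Set Implicit Arguments.
Unset Strict Implicit.
Unset Printing Implicit Defensive.

Import Order.TTheory GRing.Theory Num.Theory.
Import numFieldNormedType.Exports.

Local Open Scope classical_set_scope.
Local Open Scope ring_scope.
Local Open Scope complex_scope.
Local Open Scope sesquilinear_scope.

Section States.
Variable R : realType.
Local Notation C := R[i].

Definition braket n (u v : 'cV[C]_n) : C := (u^t* *m v) 0 0.

Definition orthonormal_basis (I : finType) n (e : I -> 'cV[C]_n) : Prop :=
  (forall i j, braket (e i) (e j) = (i == j)%:R) /\
  basis_of {:'cV[C]_n} [seq e i | i : I].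

(* Singular values with multiplicity, in nonincreasing order: the nonnegative
   square roots of the eigenvalues of the positive semidefinite M^t* *m M,
   whose [spectral_diag] has real entries listing them with multiplicity. *)
Definition singular_values n (M : 'M[C]_n) : seq R :=
  sort >=%R
    [seq Num.sqrt (complex.Re (spectral_diag (M^t* *m M) 0 k)) | k : 'I_n].

(* H (x) H is 'cV_(D * D), with |j>|k> = ket j *t ket k the basis vector of
   index [mxtens_index (j, k)]. *)
Definition coeff_mx D (psi : 'cV[C]_(D * D)) : 'M[C]_D :=
  \matrix_(j, k) psi (mxtens_index (j, k)) 0.

Definition schmidt_coeffs D (psi : 'cV[C]_(D * D)) : seq R :=
  [seq s ^+ 2 | s <- singular_values (coeff_mx psi)].

Definition product_state D (psi : 'cV[C]_(D * D)) : Prop :=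
  count (fun l => l != 0) (schmidt_coeffs psi) = 1%N.

Definition maximally_entangled D (psi : 'cV[C]_(D * D)) : Prop :=
  forall l, l \in schmidt_coeffs psi -> l = D%:R^-1.

(* Only the restriction of G to 0 <= t <= 1 matters.  [schmidt_coeffs] is
   sorted, so equality of these sequences is equality of multisets, and their
   k-th entry is the k-th ordered Schmidt coefficient. *)
Record equientangled_interpolation D
    (G : R -> 'I_D * 'I_D -> 'cV[C]_(D * D)) : Prop := {
  interp_basis : forall t : R, 0 <= t <= 1 -> orthonormal_basis (G t);
  interp_equientangled : forall t : R, 0 <= t <= 1 ->
    forall p q, schmidt_coeffs (G t p) = schmidt_coeffs (G t q);
  (* Viewing R[i] as a numFieldType equips it with its norm topology. *)
  interp_continuous : forall p,
    {within `[0, 1],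
      continuous (fun t : R => G t p : 'cV[(C : numFieldType)]_(D * D))};
  interp_schmidt_continuous : forall p (k : 'I_D),
    {within `[0, 1], continuous (fun t : R => (schmidt_coeffs (G t p))`_k)};
  interp_product : forall p, product_state (G 0 p);
  interp_maximally_entangled : forall p, maximally_entangled (G 1 p)
}.

Section Gates.
Variable D : nat.

Definition omega (x : R) : C :=
  cos (2 * pi * x / D%:R) +i* sin (2 * pi * x / D%:R).

Definition ket (k : 'I_D) : 'cV[C]_D := delta_mx k 0.

Definition projector (k : 'I_D) : 'M[C]_D := ket k *m (ket k)^t*.

Definition plus_ket : 'cV[C]_D := (Num.sqrt D%:R)^-1%:C *: \sum_k ket k.

Definition Zgate : 'M[C]_D := \sum_(k < D) omega k%:R *: projector k.

Definition CP (t : R) : 'M[C]_(D * D) :=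
  \sum_(j < D) \sum_(k < D)
    omega (j%:R * k%:R * t) *: (projector j *t projector k).

Definition graph_state (t : R) (mn : 'I_D * 'I_D) : 'cV[C]_(D * D) :=
  (Zgate ^+ mn.1 *t Zgate ^+ mn.2) *m CP t *m (plus_ket *t plus_ket).

End Gates.
End States.

(* Main.v *)
(* In coordinates, G_{m,n}(t) has entries omega^(mj + nk + jkt) / D, so inner
   products factor into two sums of roots of unity, whence orthonormality.
   With M the coefficient matrix, the (k, l) entry of M^* M is
   D^-2 * sum_j omega^((n + jt)(l - k)): changing m does nothing, changing n
   conjugates by a diagonal unitary, and M^* M is a projector of trace 1 at
   t = 0 and 1/D times the identity at t = 1.  Continuity of the ordered
   Schmidt coefficients, the sorted eigenvalues of M^* M, is Weyl's
   perturbation inequality. *)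

Require Import Defs.
From mathcomp Require Import all_boot all_order all_algebra.
From mathcomp Require Import all_classical all_reals all_analysis.
From mathcomp Require Import spectral ring lra.

Set Implicit Arguments.
Unset Strict Implicit.
Unset Printing Implicit Defensive.

Import Order.TTheory GRing.Theory Num.Theory.
Import numFieldNormedType.Exports.

Local Open Scope ring_scope.
Local Open Scope complex_scope.
Local Open Scope sesquilinear_scope.

(** * Counting tools: sorted lists and underdetermined linear systems *)

(** Let [c] be entry [k] of the sorted [s']. If entry [k] of the sorted [s] exceeded [c + e], so
    would the [k] entries before it, giving at least [k.+1] such entries in [s], whereas at most [k]
    entries of [s'] exceed [c]. *)
Lemma sort_nth_le (R : realDomainType) (s s' : seq R) (e : R) (k : nat) :
  size s = size s' ->
  (forall c, (count (fun x => (c + e < x)%R) s <=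
             count (fun x => (c < x)%R) s')%N) ->
  (k < size s)%N -> (sort >=%R s)`_k <= (sort >=%R s')`_k + e.
Proof.
move=> eq_size le_count k_lt; rewrite leNgt; apply/negP => lt_k.
set c := (sort >=%R s')`_k in lt_k.
have sorted_nth (t : seq R) i j : (i <= j)%N -> (j < size t)%N ->
    (sort >=%R t)`_j <= (sort >=%R t)`_i.
  move=> ij jt; have st : sorted >=%R (sort >=%R t).
    by apply: sort_sorted => x y; exact: le_total.
  apply: (sorted_leq_nth ge_trans ge_refl 0 st) => //; rewrite inE size_sort//.
  exact: leq_ltn_trans jt.
have := le_count c; apply/negP; rewrite -ltnNge.
rewrite -(count_sort >=%R _ s) -(count_sort >=%R _ s').
apply: (@leq_trans k.+1).
  rewrite ltnS -(cat_take_drop k (sort _ s')) count_cat.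
  have -> : count (fun x => c < x) (drop k (sort >=%R s')) = 0%N.
    apply/eqP; rewrite -leqn0 leqNgt -has_count -all_predC.
    apply/(all_nthP 0) => i; rewrite size_drop size_sort => i_lt.
    rewrite /= nth_drop -leNgt sorted_nth ?leq_addr//.
    by rewrite -ltn_subRL.
  rewrite addn0 (leq_trans (count_size _ _))// size_takel// size_sort.
  by rewrite -eq_size ltnW.
rewrite -(cat_take_drop k.+1 (sort _ s)) count_cat.
rewrite (leq_trans _ (leq_addr _ _))//.
rewrite [leqRHS](_ : _ = size (take k.+1 (sort >=%R s))); last first.
  apply/eqP; rewrite -all_count; apply/(all_nthP 0) => i.
  rewrite size_takel ?size_sort// ltnS => ik.
  by rewrite nth_take ?ltnS//; apply: lt_le_trans lt_k _; exact: sorted_nth.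
by rewrite size_takel ?size_sort.
Qed.

(** The conditions are [#|S| + #|T|] linear equations in [n] unknowns. Their coefficient columns
    form [E], whose rank is too small for its left kernel to be trivial. *)
Lemma exists_vanishing_coords (F : fieldType) n (P Q : 'M[F]_n)
    (S T : {set 'I_n}) : (#|S| + #|T| < n)%N ->
  exists2 v : 'rV_n, v != 0 &
    (forall i, i \in S -> (v *m P) 0 i = 0) /\
    (forall i, i \in T -> (v *m Q) 0 i = 0).
Proof.
move=> ST_lt.
pose E := row_mx (colsub (enum_val : 'I_#|S| -> _) P)
                 (colsub (enum_val : 'I_#|T| -> _) Q).
have : kermx E != 0.
  rewrite -mxrank_eq0 mxrank_ker subn_eq0 -ltnNge.
  exact: leq_ltn_trans (rank_leq_col E) _.
move=> /rowV0Pn[v v_ker v_neq0]; exists v => //.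
have /eqP := sub_kermxP v_ker; rewrite mul_mx_row row_mx_eq0.
move=> /andP[/eqP vP /eqP vQ]; split => i iS.
  have /rowP/(_ (enum_rank_in iS i)) := vP.
  by rewrite mulmx_colsub !mxE enum_rankK_in// => <-.
have /rowP/(_ (enum_rank_in iS i)) := vQ.
by rewrite mulmx_colsub !mxE enum_rankK_in// => <-.
Qed.

(** * Hermitian forms in unitary coordinates *)

Section QuadraticForms.
Variable C : numClosedFieldType.

(** Parseval's identity: [v *m P^t*] lists the coordinates of [v] in the orthonormal basis formed by
    the rows of [P]. *)
Lemma norm_unitary n (P : 'M[C]_n) (v : 'rV_n) : P \is unitarymx ->
  (v *m v^t*) 0 0 = \sum_i `|(v *m P^t*) 0 i| ^+ 2.
Proof.
move=> P_unitary.
have -> : v *m v^t* = (v *m P^t*) *m (v *m P^t*)^t*.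
  by rewrite trmx_mul map_mxM trmxCK !mulmxA mulmxKtV.
rewrite mxE; apply: eq_bigr => i _.
by rewrite !mxE normCK.
Qed.

Lemma quad_form_diag n (P : 'M[C]_n) (a v : 'rV_n) :
  (v *m (P^t* *m diag_mx a *m P) *m v^t*) 0 0 =
  \sum_i a 0 i * `|(v *m P^t*) 0 i| ^+ 2.
Proof.
have -> : v *m (P^t* *m diag_mx a *m P) *m v^t* =
    (v *m P^t*) *m diag_mx a *m (v *m P^t*)^t*.
  by rewrite trmx_mul map_mxM trmxCK !mulmxA.
rewrite mxE; apply: eq_bigr => i _.
by rewrite mul_mx_diag !mxE normCK mulrCA mulrA mulrAC.
Qed.

Lemma norm_row_gt0 n (v : 'rV[C]_n) : v != 0 -> 0 < (v *m v^t*) 0 0.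
Proof. by move=> v0; rewrite -dotmxE dotmx_is_dotmx. Qed.

End QuadraticForms.

(** * Weyl's inequality *)

Section GramSpectrum.
Variable R : realType.
Local Notation C := R[i].

Definition real_row n (a : 'I_n -> R) : 'rV[C]_n := \row_i (a i)%:C.

(* Weyl's inequality: a vector in the span of the eigenvectors of the first
   matrix above [c + e] and of those of the second one below [c] would violate
   the bound on the difference of the two quadratic forms. *)
Lemma weyl_le n (P Q : 'M[C]_n) (a b : 'I_n -> R) (e : R) (k : nat) :
  P \is unitarymx -> Q \is unitarymx ->
  (forall v : 'rV_n,
     (v *m (P^t* *m diag_mx (real_row a) *m P) *m v^t*) 0 0 -
     (v *m (Q^t* *m diag_mx (real_row b) *m Q) *m v^t*) 0 0
     <= e%:C * (v *m v^t*) 0 0) ->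
  (k < n)%N ->
  (sort >=%R [seq a i | i : 'I_n])`_k <=
  (sort >=%R [seq b i | i : 'I_n])`_k + e.
Proof.
move=> P_unitary Q_unitary le_form k_lt.
apply: sort_nth_le; rewrite ?size_image ?card_ord// => c.
have cntE (f : 'I_n -> R) p :
    count p [seq f i | i : 'I_n] = #|[set i | p (f i)]|.
  rewrite count_map cardE /enum_mem size_filter.
  by rewrite count_filter; apply: eq_count => i; rewrite /= !inE andbT.
rewrite !cntE leqNgt; apply/negP => lt_card.
(* [T] is the complement of the index set of the large [a i], so [lt_card] says exactly that
   [#|S| + #|T| < n]. *)
set S := [set i | c < b i] in lt_card; set T := ~: [set i | c + e < a i].
have [|v v_neq0 [vS vT]] := @exists_vanishing_coords _ n (Q^t*) (P^t*) S T.
  apply: (@leq_trans (#|[set i | c + e < a i]| + #|T|)).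
    by rewrite ltn_add2r.
  by rewrite cardsC card_ord.
have := le_form v; rewrite !quad_form_diag => le_v.
have N_gt0 := norm_row_gt0 v_neq0.
have le_b : \sum_i real_row b 0 i * `|(v *m Q^t*) 0 i| ^+ 2 <=
    c%:C * (v *m v^t*) 0 0.
  rewrite (norm_unitary _ Q_unitary) mulr_sumr; apply: ler_sum => i _.
  have [iS|] := boolP (i \in S); first by rewrite vS// normr0 expr0n !mulr0.
  rewrite inE -leNgt => b_le; apply: ler_wpM2r; first by rewrite exprn_ge0.
  by rewrite mxE lecR.
have lt_a : (c + e)%:C * (v *m v^t*) 0 0 <
    \sum_i real_row a 0 i * `|(v *m P^t*) 0 i| ^+ 2.
  rewrite (norm_unitary _ P_unitary) mulr_sumr -subr_gt0 -sumrB.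
  have term_ge0 i : 0 <= real_row a 0 i * `|(v *m P^t*) 0 i| ^+ 2 -
      (c + e)%:C * `|(v *m P^t*) 0 i| ^+ 2.
    have [iT|] := boolP (i \in T).
      by rewrite vT// normr0 expr0n !mulr0 subrr.
    rewrite !inE negbK => a_gt; rewrite -mulrBl mulr_ge0 ?exprn_ge0//.
    by rewrite mxE subr_ge0 lecR ltW.
  (* Strictness comes from one nonzero coordinate of [v]: its index lies outside [T], where [a i] is
     strictly above [c + e]. *)
  have [i wi] : exists i, (v *m P^t*) 0 i != 0.
    apply/existsP; apply: contraTT N_gt0; rewrite negb_exists => /forallP w0.
    rewrite (norm_unitary _ P_unitary) big1 ?ltxx// => i _.
    by have := w0 i; rewrite negbK => /eqP ->; rewrite normr0 expr0n.
  rewrite (bigD1 i)//= ltr_pwDl//; last by rewrite sumr_ge0.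
  have : i \notin T by apply: contraNN wi => /vT ->.
  rewrite !inE negbK => a_gt; rewrite -mulrBl mulr_gt0 ?exprn_gt0 ?normr_gt0//.
  by rewrite mxE subr_gt0 ltcR.
rewrite rmorphD mulrDl addrC in lt_a.
have := le_lt_trans (lerD le_v le_b) lt_a.
by rewrite subrK ltxx.
Qed.

(** Each product of two coordinate moduli is at most the larger one squared, hence at most the
    squared norm of [v]. The bound is crude, but it tends to 0 with the entries of [E], which is
    enough for continuity. *)
Lemma quad_form_le n (E : 'M[C]_n) (v : 'rV_n) :
  `|(v *m E *m v^t*) 0 0| <= (\sum_i \sum_j `|E i j|) * (v *m v^t*) 0 0.
Proof.
have le_N i j : `|v 0 i| * `|v 0 j| <= (v *m v^t*) 0 0.
  have NE : (v *m v^t*) 0 0 = \sum_i `|v 0 i| ^+ 2.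
    by rewrite mxE; apply: eq_bigr => l _; rewrite !mxE normCK.
  have le_sq l : `|v 0 l| ^+ 2 <= (v *m v^t*) 0 0.
    by rewrite NE (bigD1 l)//= lerDl sumr_ge0// => *; rewrite exprn_ge0.
  have [le_ij|/ltW le_ji] := real_leP (normr_real (v 0 i)) (normr_real (v 0 j)).
    by apply: le_trans (le_sq j); rewrite expr2 ler_wpM2r.
  by apply: le_trans (le_sq i); rewrite expr2 ler_wpM2l.
rewrite mxE (le_trans (ler_norm_sum _ _ _))// exchange_big mulr_suml.
apply: ler_sum => j _; rewrite normrM [(v ^t*) j 0]mxE [v^T j 0]mxE norm_conjC.
rewrite [(v *m E) 0 j]mxE mulr_suml.
rewrite (le_trans (ler_wpM2r _ (ler_norm_sum _ _ _)))// mulr_suml.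
apply: ler_sum => i _; rewrite normrM mulrAC mulrC.
by rewrite ler_wpM2l.
Qed.

(** * Spectra of Gram matrices and Schmidt coefficients *)

Lemma gram_hermitian n (M : 'M[C]_n) : M^t* *m M \is hermsymmx.
Proof.
by apply/is_hermitianmxP; rewrite expr0 scale1r trmx_mul map_mxM trmxCK.
Qed.

Lemma spectral_diag_gram_ge0 n (M : 'M[C]_n) i :
  0 <= spectral_diag (M^t* *m M) 0 i.
Proof.
set A := M^t* *m M; set P := spectralmx A.
have P_unitary : P \is unitarymx := spectral_unitarymx A.
have /orthomx_spectralP := hermitian_normalmx (gram_hermitian M).
rewrite -/A -/P invmx_unitary// => A_eq.
have : P *m A *m P^t* = diag_mx (spectral_diag A).
  by rewrite {1}A_eq !mulmxA mulmxtVK// (unitarymxP _)// mul1mx.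
move=> /matrixP/(_ i i); rewrite [RHS]mxE eqxx mulr1n => <-.
have -> : P *m A *m P^t* = (P *m M^t*) *m (P *m M^t*)^t*.
  by rewrite trmx_mul map_mxM trmxCK !mulmxA.
by rewrite mxE sumr_ge0// => j _; rewrite !mxE -normCK exprn_ge0.
Qed.

(** These are the squared singular values of [M], taken before any square root or sorting. *)
Definition gram_eig n (M : 'M[C]_n) (i : 'I_n) : R :=
  complex.Re (spectral_diag (M^t* *m M) 0 i).

Lemma gram_eig_ge0 n (M : 'M[C]_n) i : 0 <= gram_eig M i.
Proof. by have := spectral_diag_gram_ge0 M i; rewrite lecE => /andP[]. Qed.

Lemma gram_spectral n (M : 'M[C]_n) :
  M^t* *m M = (spectralmx (M^t* *m M))^t* *m
    diag_mx (real_row (gram_eig M)) *m spectralmx (M^t* *m M).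
Proof.
have -> : real_row (gram_eig M) = spectral_diag (M^t* *m M).
  apply/rowP => i; rewrite mxE RRe_real// ger0_real//.
  exact: spectral_diag_gram_ge0.
have /orthomx_spectralP := hermitian_normalmx (gram_hermitian M).
by rewrite invmx_unitary ?spectral_unitarymx.
Qed.

(** Squaring is monotone on nonnegative reals, so it commutes with sorting and undoes the square
    roots: both sides are sorted and are permutations of each other. *)
Lemma schmidt_coeffsE D (psi : 'cV[C]_(D * D)) :
  schmidt_coeffs psi = sort >=%R [seq gram_eig (coeff_mx psi) i | i : 'I_D].
Proof.
have ge_tr : transitive (>=%R : rel R) by move=> x y z /[swap]; exact: le_trans.
apply: (sorted_eq ge_trans).
- by move=> x y /andP[? ?]; apply/le_anti/andP.
- rewrite /schmidt_coeffs /singular_values.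
  apply: (@homo_sorted_in _ _ (fun x => 0 <= x) _ >=%R).
  + by move=> x y x0 y0 /= xy; rewrite lerXn2r.
  + by rewrite all_sort; apply/allP => _ /mapP[i _ ->]; rewrite sqrtr_ge0.
  + by apply: sort_sorted => x y; exact: le_total.
- by apply: sort_sorted => x y; exact: le_total.
have -> : [seq gram_eig (coeff_mx psi) i | i : 'I_D] =
    [seq s ^+ 2 | s <- [seq Num.sqrt (gram_eig (coeff_mx psi) i) | i : 'I_D]].
  by rewrite -map_comp; apply: eq_map => i /=; rewrite sqr_sqrtr ?gram_eig_ge0.
by rewrite perm_sym perm_sort perm_sym; apply: perm_map; rewrite perm_sort.
Qed.

Lemma gram_diag n (M : 'M[C]_n) :
  let P := spectralmx (M^t* *m M) in
  P *m (M^t* *m M) *m P^t* = diag_mx (real_row (gram_eig M)).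
Proof.
move=> P; have P_unitary : P \is unitarymx := spectral_unitarymx _.
by rewrite {1}gram_spectral -/P !mulmxA mulmxtVK// (unitarymxP _)// mul1mx.
Qed.

(** [N^t* *m N] is diagonalized both by [P] and by [Q *m W], the latter with the eigenvalues of [M].
    Weyl's inequality with error 0, used in both directions, identifies the two sorted spectra. *)
Lemma sorted_gram_eig_unitary n (M N W : 'M[C]_n) : W \is unitarymx ->
  N^t* *m N = W^t* *m (M^t* *m M) *m W ->
  sort >=%R [seq gram_eig M i | i : 'I_n] =
  sort >=%R [seq gram_eig N i | i : 'I_n].
Proof.
move=> W_unitary gramN.
set P := spectralmx (N^t* *m N); set Q := spectralmx (M^t* *m M).
have P_unitary : P \is unitarymx := spectral_unitarymx _.
have QW_unitary : Q *m W \is unitarymx.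
  by rewrite mul_unitarymx// spectral_unitarymx.
have NE : N^t* *m N =
    (Q *m W)^t* *m diag_mx (real_row (gram_eig M)) *m (Q *m W).
  by rewrite gramN {1}gram_spectral trmx_mul map_mxM !mulmxA.
apply: (@eq_from_nth _ 0) => [|k].
  by rewrite !size_sort !size_image.
rewrite size_sort size_image card_ord => k_lt; apply/le_anti/andP; split.
  rewrite -[leRHS]addr0; apply: (weyl_le QW_unitary P_unitary) => // v.
  by rewrite -NE -gram_spectral subrr mul0r.
rewrite -[leRHS]addr0; apply: (weyl_le P_unitary QW_unitary) => // v.
by rewrite -NE -gram_spectral subrr mul0r.
Qed.

(** Idempotence makes every eigenvalue 0 or 1, so the number of nonzero ones is their sum, the
    trace. *)
Lemma gram_eig_idempotent_count n (M : 'M[C]_n) (A := M^t* *m M) :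
  A *m A = A -> \tr A = 1 ->
  count (fun l => l != 0) [seq gram_eig M i | i : 'I_n] = 1%N.
Proof.
move=> idem_A tr_A; set P := spectralmx A.
have P_unitary : P \is unitarymx := spectral_unitarymx A.
have diagE : P *m A *m P^t* = diag_mx (real_row (gram_eig M)) := gram_diag M.
clearbody P; clearbody A.
have eig_sq i : gram_eig M i * gram_eig M i = gram_eig M i.
  have : (P *m A *m P^t*) *m (P *m A *m P^t*) = P *m A *m P^t*.
    by rewrite !mulmxA mulmxKtV// -(mulmxA P A A) idem_A.
  rewrite diagE mulmx_diag => /matrixP/(_ i i).
  by rewrite !mxE eqxx !mulr1n -rmorphM => /complexI.
have sum_eig : \sum_i gram_eig M i = 1.
  apply: complexI; rewrite rmorph_sum rmorph1 -tr_A.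
  rewrite -[A in RHS]mul1mx -(mulmx1C (unitarymxP P_unitary)) -mulmxA.
  rewrite mxtrace_mulC diagE mxtrace_diag; apply: eq_bigr => i _.
  by rewrite mxE.
apply/eqP; rewrite -(eqr_nat R); apply/eqP; rewrite -[RHS]sum_eig.
rewrite count_map -sum1_count natr_sum big_mkcond big_enum /=.
apply: eq_bigr => i _; case: eqVneq => [->//|eig_neq0].
by apply: (mulIf eig_neq0); rewrite mul1r eig_sq.
Qed.

Lemma gram_eig_scalar n (M : 'M[C]_n) (c : R) i :
  M^t* *m M = c%:C%:M -> gram_eig M i = c.
Proof.
move=> gramM; have := gram_diag M; rewrite /= gramM mul_mx_scalar -scalemxAl.
rewrite (unitarymxP _) ?spectral_unitarymx// => /matrixP/(_ i i).
by rewrite !mxE eqxx mulr1 mulr1n => /complexI.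
Qed.

(** Pairing a vanishing combination with one vector of the family isolates its coefficient, so the
    family is free; its cardinality is the dimension. *)
Lemma orthonormal_basis_card (I : finType) n (e : I -> 'cV[C]_n) :
  (forall i j, braket (e i) (e j) = (i == j)%:R) -> #|I| = n ->
  orthonormal_basis e.
Proof.
move=> orth card_I; split => //.
have free_e : free [seq e i | i : I].
  apply/(@freeP _ _ _ (image_tuple e I)) => k sum0 i.
  have := congr1 (braket (e (enum_val i))) sum0.
  rewrite /braket mulmx0 mulmx_sumr summxE mxE (bigD1 i)//= big1.
    rewrite addr0 (nth_image (0 : 'cV_n)) -scalemxAr mxE.
    by rewrite -/(braket _ _) orth eqxx mulr1.
  move=> j ji; rewrite (nth_image (0 : 'cV_n)) -scalemxAr mxE.
  rewrite -/(braket _ _) orth (inj_eq enum_val_inj) eq_sym (negPf ji).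
  exact: mulr0.
rewrite basisEfree free_e subvf size_image card_I dimvf dim_matrix.
by rewrite -[X in (X <= _)%N]/(n * 1)%N muln1 leqnn.
Qed.

(** * Continuity of complex functions, matrices and sorted spectra *)

(** Splitting into two real functions makes the continuity of [cos] and [sin] directly applicable;
    [near_complex] and [continuous_matrix] then return to the norm of [R[i]]. *)
Definition continuous_parts (f : R -> C) : Prop :=
  continuous (fun t => complex.Re (f t)) /\
  continuous (fun t => complex.Im (f t)).

Lemma continuous_parts_cst (z : C) : continuous_parts (fun=> z).
Proof. by split=> t; exact: cvg_cst. Qed.

Lemma continuous_partsD f g : continuous_parts f -> continuous_parts g ->
  continuous_parts (fun t => f t + g t).
Proof.
move=> [fRe fIm] [gRe gIm]; split=> t.
  under eq_fun do rewrite raddfD /=.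
  exact: (cvgD (fRe t) (gRe t)).
under eq_fun do rewrite raddfD /=.
exact: (cvgD (fIm t) (gIm t)).
Qed.

Lemma continuous_partsM f g : continuous_parts f -> continuous_parts g ->
  continuous_parts (fun t => f t * g t).
Proof.
move=> [fRe fIm] [gRe gIm].
have ReM (z w : C) : complex.Re (z * w) =
    complex.Re z * complex.Re w - complex.Im z * complex.Im w.
  by case: z w => ? ? [].
have ImM (z w : C) : complex.Im (z * w) =
    complex.Re z * complex.Im w + complex.Im z * complex.Re w.
  by case: z w => ? ? [].
split=> t.
  under eq_fun do rewrite ReM.
  exact: (cvgB (cvgM (fRe t) (gRe t)) (cvgM (fIm t) (gIm t))).
under eq_fun do rewrite ImM.
exact: (cvgD (cvgM (fRe t) (gIm t)) (cvgM (fIm t) (gRe t))).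
Qed.

Lemma continuous_parts_sum (I : finType) (f : I -> R -> C) :
  (forall i, continuous_parts (f i)) ->
  continuous_parts (fun t => \sum_i f i t).
Proof.
move=> cf; elim: (index_enum I) => [|i r IH].
  under eq_fun do rewrite big_nil; exact: continuous_parts_cst.
under eq_fun do rewrite big_cons; exact: continuous_partsD.
Qed.

Lemma continuous_parts_omega D (f : R -> R) :
  continuous f -> continuous_parts (fun t => omega D (f t)).
Proof.
move=> cf; have cg : continuous (fun t => 2 * pi * f t / D%:R).
  by move=> t; apply: cvgMl; apply: cvgMr; exact: cf.
by split=> t; apply: (continuous_comp (cg t));
  [exact: continuous_cos|exact: continuous_sin].
Qed.

Lemma near_complex (f : R -> C) (t e : R) : continuous_parts f -> 0 < e ->
  \forall s \near t, `|f t - f s| < e%:C.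
Proof.
move=> [fRe fIm] e_gt0; have e2 : 0 < e / 2 by rewrite divr_gt0.
have /cvgrPdist_lt/(_ _ e2) nRe := fRe t.
have /cvgrPdist_lt/(_ _ e2) nIm := fIm t.
near=> s; have -> : f t - f s = (complex.Re (f t) - complex.Re (f s))%:C +
    'i%C * (complex.Im (f t) - complex.Im (f s))%:C.
  by rewrite -!raddfB -complexE.
rewrite (le_lt_trans (ler_normD _ _))// normrM [e]splitr [X in _ < X]rmorphD.
rewrite ltrD//.
  by rewrite normc_def /= expr0n addr0 sqrtr_sqr ltcR; near: s.
rewrite !normc_def /= expr0n expr1n /= add0r addr0 sqrtr1 mul1r sqrtr_sqr ltcR.
by near: s.
Unshelve. all: by end_near. Qed.

Lemma near_matrix m n (M : R -> 'M[C]_(m, n)) (t e : R) :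
  (forall i j, continuous_parts (fun s => M s i j)) -> 0 < e ->
  \forall s \near t, forall i j, `|M t i j - M s i j| < e%:C.
Proof.
move=> cM e_gt0.
apply: (@filter_forall _ _ (fun i s => forall j, `|M t i j - M s i j| < e%:C)
  (nbhs t) (nbhs_filter t)).
move=> i; apply: (@filter_forall _ _ (fun j s => `|M t i j - M s i j| < e%:C)
  (nbhs t) (nbhs_filter t)).
by move=> j; exact: near_complex (cM i j) e_gt0.
Qed.

Lemma continuous_matrix m n (M : R -> 'M[C]_(m, n)) :
  (forall i j, continuous_parts (fun t => M t i j)) ->
  continuous (M : R -> 'M[(C : numFieldType)]_(m, n)).
Proof.
move=> cM t; apply/cvg_ballP => e e_gt0.
(* Radii of balls over [R[i]] are themselves complex; a positive one is real. *)
have [r r_gt0 er] : exists2 r : R, 0 < r & e = r%:C.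
  exists (complex.Re e); last by rewrite RRe_real// gtr0_real.
  by move: e_gt0; rewrite ltcE => /andP[].
apply: filterS (near_matrix t cM r_gt0) => s lt_r; split=> // i j.
by rewrite er; exact: lt_r.
Qed.

Lemma continuous_sorted_gram_eig n (M : R -> 'M[C]_n) (k : 'I_n) :
  (forall i j, continuous_parts (fun t => ((M t)^t* *m M t) i j)) ->
  continuous (fun t => (sort >=%R [seq gram_eig (M t) i | i : 'I_n])`_k).
Proof.
move=> cM t; apply/cvgrPdist_le => e e_gt0.
have n_gt0 : (0 < n)%N by apply: leq_ltn_trans (ltn_ord k).
(* [quad_form_le] sums the [n * n] entrywise errors, so an error of at most [r] in each adds up to
   at most [e]. *)
pose r := e / (n * n)%:R.
have r_gt0 : 0 < r by rewrite divr_gt0// ltr0n muln_gt0 n_gt0.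
have weyl (A B : 'M[C]_n) :
    (forall i j, `|(A^t* *m A) i j - (B^t* *m B) i j| <= r%:C) ->
    (sort >=%R [seq gram_eig A i | i : 'I_n])`_k <=
    (sort >=%R [seq gram_eig B i | i : 'I_n])`_k + e.
  move=> le_r.
  apply: (weyl_le (spectral_unitarymx (A^t* *m A))
                  (spectral_unitarymx (B^t* *m B))) => // v.
  rewrite -!gram_spectral.
  have formE : (v *m (A^t* *m A) *m v^t*) 0 0 - (v *m (B^t* *m B) *m v^t*) 0 0 =
      (v *m (A^t* *m A - B^t* *m B) *m v^t*) 0 0.
    by rewrite mulmxBr mulmxBl [RHS]mxE [X in _ = _ + X]mxE.
  have form_ge0 (N : 'M[C]_n) : 0 <= (v *m (N^t* *m N) *m v^t*) 0 0.
    have -> : v *m (N^t* *m N) *m v^t* = (v *m N^t*) *m (v *m N^t*)^t*.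
      by rewrite trmx_mul map_mxM trmxCK !mulmxA.
    by rewrite -dotmxE dnorm_ge0.
  (* In the partial order of [R[i]], a number is bounded by its modulus only when it is real; here
     it is a difference of two squared norms. *)
  have E_real : (v *m (A^t* *m A - B^t* *m B) *m v^t*) 0 0 \is Num.real.
    by rewrite -formE rpredB// ger0_real.
  rewrite formE (le_trans (real_ler_norm E_real))//.
  rewrite (le_trans (quad_form_le _ _))//.
  apply: ler_wpM2r; first by rewrite -dotmxE dnorm_ge0.
  have -> : e%:C = \sum_(i < n) \sum_(j < n) r%:C.
    rewrite !sumr_const !card_ord -mulrnA -rmorphMn /= /r -mulr_natr.
    by rewrite divfK// pnatr_eq0 muln_eq0 negb_or -lt0n n_gt0.
  by apply: ler_sum => i _; apply: ler_sum => j _; rewrite mxE [X in _ + X]mxE.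
apply: filterS (near_matrix t cM r_gt0) => s lt_r.
rewrite ler_distl; apply/andP; split.
  by rewrite lerBlDr; apply: weyl => i j; rewrite distrC ltW.
by apply: weyl => i j; exact: ltW.
Qed.

End GramSpectrum.

(** * Phases and sums of roots of unity *)

Section Omega.
Variables (R : realType) (D : nat).
Implicit Types x y : R.
Local Notation omega := (@omega R D).

Lemma omega0 : omega 0 = 1.
Proof. by rewrite /Defs.omega mulr0 mul0r cos0 sin0. Qed.

Lemma omegaD x y : omega (x + y) = omega x * omega y.
Proof.
rewrite /Defs.omega mulrDr mulrDl cosD sinD; simpc.
by congr (_ +i* _); rewrite addrC [X in X + _]mulrC.
Qed.

Lemma omegaMn x n : omega (n%:R * x) = omega x ^+ n.
Proof.
elim: n => [|n IH]; first by rewrite mul0r omega0.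
by rewrite -natr1 mulrDl mul1r omegaD IH exprSr.
Qed.

Lemma conj_omega x : (omega x)^*%R = omega (- x).
Proof. by rewrite /Defs.omega mulrN mulNr cosN sinN. Qed.

Lemma omegaNK x : omega (- x) * omega x = 1.
Proof. by rewrite -omegaD addNr omega0. Qed.

Hypothesis D_gt0 : (0 < D)%N.

Lemma omega_order : omega D%:R = 1.
Proof.
rewrite /Defs.omega mulfK ?pnatr_eq0 -?lt0n//.
by rewrite mulr_natl cos2pi sin2pi.
Qed.

(** The real part is already different from 1: it equals [1 - 2 * sin y ^+ 2] with [y] the half
    angle, which lies strictly between 0 and [pi]. *)
Lemma omega_neq1 x : 0 < x < D%:R -> omega x != 1.
Proof.
move=> /andP[x0 xD]; have D0 : 0 < D%:R :> R by rewrite ltr0n.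
pose y := pi * x / D%:R.
have y_itv : 0 < y < pi.
  rewrite divr_gt0 ?mulr_gt0 ?pi_gt0//= ltr_pdivrMr//.
  by rewrite ltr_pM2l ?pi_gt0.
rewrite eq_complex negb_and; apply/orP; left => /=.
have -> : 2 * pi * x / D%:R = y *+ 2 by rewrite /y mulr2n; ring.
rewrite cos_mulr2n cos2sin2 lt_eqF//.
have : 0 < sin y ^+ 2 by rewrite exprn_gt0// sin_gt0_pi.
lra.
Qed.

Lemma omega_inj : injective (fun k : 'I_D => omega k%:R).
Proof.
have neq (k l : 'I_D) : (k < l)%N -> omega k%:R != omega l%:R.
  move=> kl; have := @omega_neq1 (l%:R - k%:R).
  rewrite subr_gt0 ltr_nat kl ltrBlDr -natrD ltr_nat ltn_addr// => /(_ isT).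
  apply: contraNneq => eq_kl.
  by rewrite omegaD -eq_kl mulrC omegaNK.
move=> k l /= eq_kl; apply/val_inj; case: (ltngtP k l) => // /neq.
  by rewrite eq_kl eqxx.
by rewrite eq_kl eqxx.
Qed.

(** Orthogonality of the characters of the cyclic group of order [D]. For distinct indices this is a
    geometric sum with ratio [z != 1]; multiplied by [z - 1] it telescopes to [z ^+ D - 1], which is
    0. *)
Lemma sum_omega (k l : 'I_D) :
  \sum_(j < D) omega (j%:R * (l%:R - k%:R)) = (k == l)%:R * D%:R.
Proof.
under eq_bigr do rewrite omegaMn.
have [<-|neq_kl] := eqVneq k l.
  rewrite subrr omega0 mul1r.
  under eq_bigr do rewrite expr1n.
  by rewrite sumr_const card_ord.
rewrite mul0r; set z := omega _.
have z1 : z - 1 != 0.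
  rewrite subr_eq0 /z; apply: contra_neq neq_kl => eq1.
  apply/omega_inj => /=.
  by rewrite -[l%:R in RHS](subrK k%:R) omegaD eq1 mul1r.
apply/eqP; rewrite -(mulrI_eq0 _ (mulfI z1)) -subrX1 -omegaMn mulrBr omegaD.
rewrite [D%:R * l%:R]mulrC omegaMn omega_order expr1n mul1r -conj_omega.
by rewrite [D%:R * k%:R]mulrC omegaMn omega_order expr1n conjC1 subrr.
Qed.

End Omega.

(** * Amplitudes, inner products and Gram matrices of the graph states *)

Section GraphState.
Variables (R : realType) (D : nat).
Local Notation C := R[i].
Local Notation omega := (@omega R D).

Lemma tens_colE n (u v : 'cV[C]_n) (j k : 'I_n) :
  (u *t v : 'cV_(n * n)) (mxtens_index (j, k)) 0 = u j 0 * v k 0.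
Proof.
rewrite mxE mxtens_indexK /=.
by congr (u _ _ * v _ _); apply/ord1.
Qed.

Lemma projector_plus (j : 'I_D) :
  projector R j *m plus_ket R D = (Num.sqrt D%:R)^-1%:C *: ket R j.
Proof.
rewrite /plus_ket -scalemxAr mulmx_sumr; congr (_ *: _).
rewrite /projector trmx_delta map_delta_mx mul_delta_mx (bigD1 j)//= big1.
  by rewrite mul_delta_mx addr0.
by move=> k kj; rewrite mul_delta_mx_cond eq_sym (negPf kj).
Qed.

Lemma Zgate_pow_ket (m : nat) (k : 'I_D) :
  Zgate R D ^+ m *m ket R k = omega (m%:R * k%:R) *: ket R k.
Proof.
elim: m => [|m IH]; first by rewrite expr0 mul1mx mul0r omega0 scale1r.
have -> : Zgate R D ^+ m.+1 = Zgate R D *m Zgate R D ^+ m by rewrite exprS.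
rewrite -mulmxA IH -scalemxAr -natr1 mulrDl omegaD mul1r -scalerA.
congr (_ *: _); rewrite mulmx_suml (bigD1 k)//= big1 ?addr0.
  by rewrite -scalemxAl /projector trmx_delta map_delta_mx !mul_delta_mx.
move=> l lk; rewrite -scalemxAl /projector trmx_delta map_delta_mx mul_delta_mx.
by rewrite mul_delta_mx_cond (negPf lk) scaler0.
Qed.

(** All gates are diagonal, so each only multiplies the amplitude of a basis vector by a phase; the
    two factors [plus_ket] supply the modulus [D%:R^-1]. *)
Lemma graph_stateE (t : R) (m n j k : 'I_D) :
  graph_state t (m, n) (mxtens_index (j, k)) 0 =
  D%:R^-1 * omega (m%:R * j%:R + n%:R * k%:R + j%:R * k%:R * t).
Proof.
have -> : graph_state t (m, n) = \sum_(a < D) \sum_(b < D)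
    (omega (a%:R * b%:R * t) * (Num.sqrt D%:R)^-1%:C ^+ 2 *
     omega (m%:R * a%:R) * omega (n%:R * b%:R)) *: (ket R a *t ket R b).
  rewrite /graph_state -mulmxA mulmx_suml mulmx_sumr; apply: eq_bigr => a _.
  rewrite mulmx_suml mulmx_sumr; apply: eq_bigr => b _.
  rewrite -scalemxAl -scalemxAr !tensmx_mul !projector_plus -!scalemxAr.
  rewrite !Zgate_pow_ket.
  apply/matrixP => x y; rewrite !mxE; ring.
rewrite summxE (bigD1 j)//= summxE (bigD1 k)//= !big1 => [|a aj|b bk].
- rewrite !addr0 mxE tens_colE !mxE !eqxx mulr1 mulr1.
  rewrite -rmorphXn exprVn sqr_sqrtr ?ler0n// fmorphV rmorph_nat !omegaD.
  ring.
- rewrite summxE big1// => b _; rewrite mxE tens_colE !mxE.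
  by rewrite eq_sym (negPf aj) mul0r mulr0.
- by rewrite mxE tens_colE !mxE [k == b]eq_sym (negPf bk) !mulr0.
Qed.

Hypothesis D_gt0 : (0 < D)%N.

Let D_neq0 : D%:R != 0 :> C.
Proof. by rewrite pnatr_eq0 -lt0n. Qed.

Lemma braket_graph_state (t : R) (p q : 'I_D * 'I_D) :
  braket (graph_state t p) (graph_state t q) = (p == q)%:R.
Proof.
case: p q => [m n] [m' n'].
(* The phase of [CP t] is the same in both states and cancels against its conjugate, so the double
   sum splits into a sum over [j] times a sum over [k]. *)
have -> : braket (graph_state t (m, n)) (graph_state t (m', n')) =
  (D%:R^-1 * \sum_(j < D) omega (j%:R * (m'%:R - m%:R))) *
  (D%:R^-1 * \sum_(k < D) omega (k%:R * (n'%:R - n%:R))).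
  rewrite mulrACA mulr_sum mulr_sumr /braket mxE; apply: eq_bigr => x _.
  case: (mxtens_indexP x) => j k; rewrite !mxtens_indexK /=.
  rewrite [(_ ^t*) 0 _]mxE [_^T 0 _]mxE !graph_stateE.
  rewrite rmorphM /= conj_omega fmorphV /= conjC_nat.
  rewrite mulrACA -!omegaD; congr (_ * omega _); ring.
rewrite !sum_omega// [_ * D%:R]mulrC [_ * D%:R]mulrC !mulKf// -natrM mulnb.
by rewrite xpair_eqE.
Qed.

Lemma gramE (t : R) (m n k l : 'I_D) :
  let M := coeff_mx (graph_state t (m, n)) in
  (M^t* *m M) k l =
  D%:R ^- 2 * \sum_(j < D) omega ((n%:R + j%:R * t) * (l%:R - k%:R)).
Proof.
move=> M; rewrite mxE mulr_sumr; apply: eq_bigr => j _.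
rewrite [(_ ^t*) _ _]mxE [_^T _ _]mxE ![M _ _]mxE !graph_stateE.
rewrite rmorphM /= conj_omega fmorphV /= conjC_nat -exprVn expr2.
rewrite mulrACA -omegaD; congr (_ * omega _); ring.
Qed.

Local Notation gram psi := ((coeff_mx psi)^t* *m coeff_mx psi).

Lemma schmidt_graph_state (t : R) (p q : 'I_D * 'I_D) :
  schmidt_coeffs (graph_state t p) = schmidt_coeffs (graph_state t q).
Proof.
case: p q => [m n] [m' n']; rewrite !schmidt_coeffsE.
(* Conjugation by [diag_mx w] multiplies entry [(k, l)] by [omega ((n' - n) * (l - k))], which turns
   [n] into [n'] in [gramE]. *)
pose w : 'rV[C]_D := \row_k omega ((n'%:R - n%:R) * k%:R).
apply: (@sorted_gram_eig_unitary _ _ _ _ (diag_mx w)).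
  apply/unitarymxP; rewrite tr_diag_mx map_diag_mx mulmx_diag.
  apply/matrixP => k l; rewrite !mxE; case: eqVneq => //= _.
  by rewrite conj_omega mulrC omegaNK.
rewrite tr_diag_mx map_diag_mx mul_mx_diag mul_diag_mx.
apply/matrixP => k l; rewrite [RHS]mxE [X in X * _]mxE !gramE !mxE.
rewrite /= conj_omega.
rewrite mulrCA -mulrA; congr (_ * _); rewrite mulr_sumr mulr_suml.
by apply: eq_bigr => j _; rewrite -!omegaD; congr (omega _); ring.
Qed.

Lemma gram_graph_state0 (m n k l : 'I_D) :
  gram (graph_state (0 : R) (m, n)) k l =
  D%:R^-1 * omega (n%:R * (l%:R - k%:R)).
Proof.
rewrite gramE; under eq_bigr do rewrite mulr0 addr0.
rewrite sumr_const card_ord -[omega _ *+ D]mulr_natr expr2 invfM.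
by rewrite mulrCA mulfVK// mulrC.
Qed.

(** At [t = 1] the sum over [j] in [gramE] becomes a full character sum, which vanishes off the
    diagonal and equals [D] on it. *)
Lemma gram_graph_state1 (m n : 'I_D) :
  gram (graph_state (1 : R) (m, n)) = (D%:R^-1)%:C%:M.
Proof.
apply/matrixP => k l; rewrite gramE [RHS]mxE.
under eq_bigr do rewrite mulr1 mulrDl omegaD.
rewrite -mulr_sumr sum_omega//; have [->|kl] := eqVneq k l; last first.
  by rewrite mul0r !mulr0.
rewrite subrr mulr0 omega0 !mul1r fmorphV rmorph_nat mulr1n.
by rewrite invfM mulfVK.
Qed.

(** In the square of the Gram matrix the intermediate index drops out of the phases, so its [D]
    equal terms absorb one factor [D%:R^-1]: the matrix is idempotent. Its diagonal entries are all
    [D%:R^-1], hence trace 1. *)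
Lemma product_graph_state0 (p : 'I_D * 'I_D) :
  product_state (graph_state (0 : R) p).
Proof.
case: p => m n; rewrite /product_state schmidt_coeffsE count_sort.
apply: gram_eig_idempotent_count.
  apply/matrixP => k l; rewrite mxE.
  under eq_bigr do rewrite !gram_graph_state0 mulrACA -omegaD -mulrDr
    [X in Defs.omega _ (_ * X)]addrC subrKA.
  rewrite sumr_const card_ord gram_graph_state0 -[LHS]mulr_natr.
  by rewrite mulrAC mulfVK.
rewrite /mxtrace.
under eq_bigr do rewrite gram_graph_state0 subrr mulr0 omega0 mulr1.
by rewrite sumr_const card_ord -[LHS]mulr_natr mulVf.
Qed.

Lemma maximally_entangled_graph_state1 (p : 'I_D * 'I_D) :
  maximally_entangled (graph_state (1 : R) p).
Proof.
case: p => m n l; rewrite schmidt_coeffsE mem_sort => /mapP[i _ ->].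
exact/gram_eig_scalar/gram_graph_state1.
Qed.

Lemma continuous_schmidt_graph_state (p : 'I_D * 'I_D) (k : 'I_D) :
  continuous (fun t : R => (schmidt_coeffs (graph_state t p))`_k).
Proof.
case: p => m n; under eq_fun do rewrite schmidt_coeffsE.
apply: continuous_sorted_gram_eig => a b.
under eq_fun do rewrite gramE.
apply: continuous_partsM; first exact: continuous_parts_cst.
apply: continuous_parts_sum => j; apply: continuous_parts_omega => t.
by apply: cvgMl; apply: cvgD; [exact: cvg_cst|apply: cvgMr; exact: cvg_id].
Qed.

Lemma continuous_graph_state (p : 'I_D * 'I_D) :
  continuous (fun t : R => graph_state t p : 'cV[(C : numFieldType)]_(D * D)).
Proof.
case: p => m n; apply: continuous_matrix => x y; rewrite (ord1 y).
case: (mxtens_indexP x) => j k; under eq_fun do rewrite graph_stateE.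
apply: continuous_partsM; first exact: continuous_parts_cst.
apply: continuous_parts_omega => t.
by apply: cvgD; [exact: cvg_cst|apply: cvgMr; exact: cvg_id].
Qed.

End GraphState.

Theorem theorem2 (R : realType) (D : nat) (D_gt0 : (0 < D)%N) :
  @equientangled_interpolation R D (@graph_state R D).
Proof.
split=> [t _|t _|p|p k||].
- apply: orthonormal_basis_card; last by rewrite card_prod !card_ord.
  exact: braket_graph_state.
- exact: schmidt_graph_state.
(* Continuity holds on the whole real line and restricts to the interval. *)
- exact/continuous_subspaceT/continuous_graph_state.
- exact/continuous_subspaceT/continuous_schmidt_graph_state.
- exact: product_graph_state0.
- exact: maximally_entangled_graph_state1.
Qed.
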